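(* Let $\{\mathcal{F}^j=(\mathcal{F}^j_1,\dots,\mathcal{F}^j_r)\}_{j=1}^m$ be a family of flags of type $(t_1,\dots,t_r)$ on $\mathbb{F}_q^n$, let $a=\max\{i\mid 2t_i\leq n\}$, $b=\min\{i\mid 2t_i\geq n\}$, and let $\mathbf{H}$ be a subgroup of $\mathrm{GL}(n,q)$ such that every orbit $\mathrm{Orb}_{\mathbf{H}}(\mathcal{F}^j)$, $1\leq j\leq m$, is a disjoint flag code. If the subspaces $\mathcal{F}^1_a,\dots,\mathcal{F}^m_a$ lie in pairwise different $\mathbf{H}$-orbits and the subspaces $\mathcal{F}^1_b,\dots,\mathcal{F}^m_b$ lie in pairwise different $\mathbf{H}$-orbits, then $$\Big|\bigcup_{j=1}^m\mathrm{Orb}_{\mathbf{H}}(\mathcal{F}^j)\Big|=\sum_{j=1}^m|\mathrm{Orb}_{\mathbf{H}}(\mathcal{F}^j)|.$$ Moreover, under these hypotheses the following are equivalent: (i) $\bigcup_{j=1}^m\mathrm{Orb}_{\mathbf{H}}(\mathcal{F}^j)$ is an optimum distance flag code; (ii) the codes $\bigcup_{j=1}^m\mathrm{Orb}_{\mathbf{H}}(\mathcal{F}^j_a)$ and $\bigcup_{j=1}^m\mathrm{Orb}_{\mathbf{H}}(\mathcal{F}^j_b)$ have the maximum possible distance.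
   Context: A flag of type $(t_1,\dots,t_r)$, $0<t_1<\dots<t_r<n$, is a chain $\mathcal{F}_1\subsetneq\cdots\subsetneq\mathcal{F}_r$ of subspaces of $\mathbb{F}_q^n$ with $\dim\mathcal{F}_i=t_i$. A flag code is a nonempty set $\mathcal{C}$ of flags of a fixed type; its $i$-th projected code is $\mathcal{C}_i=\{\mathcal{F}_i\mid\mathcal{F}\in\mathcal{C}\}$; $\mathcal{C}$ is disjoint if $|\mathcal{C}|=|\mathcal{C}_1|=\dots=|\mathcal{C}_r|$. $\mathrm{GL}(n,q)$ acts on subspaces by $\mathcal{V}\cdot A=\mathrm{rowsp}(VA)$ where $\mathcal{V}=\mathrm{rowsp}(V)$, and on flags componentwise. $d_S(\mathcal{U},\mathcal{V})=\dim(\mathcal{U}+\mathcal{V})-\dim(\mathcal{U}\cap\mathcal{V})$; a set of $k$-dimensional subspaces has maximum (possible) distance if its minimum distance between distinct members (defined as $0$ for a single element) equals $2k$ when $2k\leq n$ and $2(n-k)$ when $2k\geq n$. With $d_f(\mathcal{F},\mathcal{F}')=\sum_i d_S(\mathcal{F}_i,\mathcal{F}'_i)$ and $d_f(\mathcal{C})$ the least flag distance between distinct members ($0$ if $|\mathcal{C}|=1$), $\mathcal{C}$ is an optimum distance flag code if $d_f(\mathcal{C})=2\left(\sum_{2t_i\leq n}t_i+\sum_{2t_i>n}(n-t_i)\right)$. If one of the indices $a,b$ does not exist (its defining set is empty), conditions referring to it are omitted. *)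

(* Defs.v *)
From HB Require Import structures.
From mathcomp Require Import all_boot all_order all_algebra all_fingroup.

Set Implicit Arguments.
Unset Strict Implicit.
Unset Printing Implicit Defensive.

Import GRing.Theory.

(* Over a finite field the library's type of subspaces, a subtype of a matrix *)
(* type, is finite; the library only declares it as a choiceType.             *)
Section FiniteVspace.
Import VectorInternalTheory.
Variables (F : finFieldType) (vT : vectType F).
HB.instance Definition _ := [Countable of {vspace vT} by <:].
HB.instance Definition _ := [Finite of {vspace vT} by <:].
End FiniteVspace.

Section MinimumDistance.
Variables (T : finType) (d : T -> T -> nat).

Definition distinct_pairs (C : {set T}) : {set T * T} :=
  [set p | [&& p.1 \in C, p.2 \in C & p.1 != p.2]].

Definition min_distance (C : {set T}) : nat :=
  if [pick p in distinct_pairs C] is Some p0 then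
    let p := [arg min_(p < p0 in distinct_pairs C) d p.1 p.2] in d p.1 p.2
  else 0.

End MinimumDistance.

Section Codes.
Variables (F : finFieldType) (n : nat).
Implicit Types (U V : {vspace 'rV[F]_n}).

(* The subtraction of naturals is exact: U :&: V is a subspace of U + V. *)
Definition subspace_distance U V : nat := \dim (U + V) - \dim (U :&: V).

(* The two values prescribed when 2 * k = n coincide. *)
Definition max_distance_code (k : nat) (C : {set {vspace 'rV[F]_n}}) : Prop :=
  [/\ C != set0, forall U, U \in C -> \dim U = k
    & min_distance subspace_distance C
      = if 2 * k <= n then 2 * k else 2 * (n - k)].

Variable r : nat.
Implicit Types (t : 'I_r -> nat) (f g : {ffun 'I_r -> {vspace 'rV[F]_n}})
  (C : {set {ffun 'I_r -> {vspace 'rV[F]_n}}}).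

Definition is_flag_type t : Prop :=
  [/\ 0 < r, forall i, 0 < t i < n & forall i j : 'I_r, i < j -> t i < t j].

Definition is_flag t f : Prop :=
  (forall i, \dim (f i) = t i) /\
  (forall i j : 'I_r, i < j -> (f i <= f j)%VS && (f i != f j)).

Definition flag_code t C : Prop :=
  C != set0 /\ (forall f, f \in C -> is_flag t f).

Definition projected_code C (i : 'I_r) : {set {vspace 'rV[F]_n}} :=
  [set f i | f : {ffun 'I_r -> {vspace 'rV[F]_n}} in C].

Definition disjoint_flag_code t C : Prop :=
  flag_code t C /\ (forall i, #|projected_code C i| = #|C|).

Definition flag_distance f g : nat :=
  \sum_(i < r) subspace_distance (f i) (g i).

Definition optimum_distance_flag_code t C : Prop :=
  flag_code t C /\
  min_distance flag_distance C
  = 2 * (\sum_(i < r | 2 * t i <= n) t i + \sum_(i < r | n < 2 * t i) (n - t i)).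

End Codes.

(* a = max {i | 2 t_i <= n} and b = min {i | 2 t_i >= n} are predicates, so   *)
(* that a condition quantified over such an index is void if there is none.   *)
Definition is_index_a (n r : nat) (t : 'I_r -> nat) (a : 'I_r) : Prop :=
  2 * t a <= n /\ (forall i : 'I_r, 2 * t i <= n -> i <= a).

Definition is_index_b (n r : nat) (t : 'I_r -> nat) (b : 'I_r) : Prop :=
  n <= 2 * t b /\ (forall i : 'I_r, n <= 2 * t i -> b <= i).

(* The dimension is a successor because {'GL_n[F]} consists of matrices of    *)
(* size n.-1.+1.                                                              *)
Section Actions.
Variables (F : finFieldType) (n : nat).

(* The image of rowsp(V) under v |-> v *m A is rowsp(V *m A). *)
Definition subspace_act (U : {vspace 'rV[F]_n.+1}) (A : {'GL_n.+1[F]}) :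
    {vspace 'rV[F]_n.+1} :=
  (linfun (mulmxr (GLval A)) @: U)%VS.

Lemma subspace_act_is_total :
  (forall U, subspace_act U 1%g = U) /\
  (forall U, act_morph subspace_act U).
Proof.
split=> [U|U A B]; apply/vspaceP=> v.
  rewrite /subspace_act (_ : linfun _ = \1%VF) ?lim1g //.
  by apply/lfunP=> w; rewrite lfunE /= id_lfunE mulmx1.
rewrite /subspace_act -limg_comp.
congr (v \in (_ @: U)%VS).
by apply/lfunP=> w; rewrite comp_lfunE !lfunE /= mulmxA.
Qed.

Definition subspace_action : {action {'GL_n.+1[F]} &-> {vspace 'rV[F]_n.+1}} :=
  TotalAction (proj1 subspace_act_is_total) (proj2 subspace_act_is_total).

Variable r : nat.

Definition flag_act (f : {ffun 'I_r -> {vspace 'rV[F]_n.+1}})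
    (A : {'GL_n.+1[F]}) : {ffun 'I_r -> {vspace 'rV[F]_n.+1}} :=
  [ffun i => subspace_act (f i) A].

Lemma flag_act_is_total :
  (forall f, flag_act f 1%g = f) /\ (forall f, act_morph flag_act f).
Proof.
have [act1 actM] := subspace_act_is_total.
by split=> [f|f A B]; apply/ffunP=> i; rewrite !ffunE ?act1 ?actM.
Qed.

Definition flag_action :
    {action {'GL_n.+1[F]} &-> {ffun 'I_r -> {vspace 'rV[F]_n.+1}}} :=
  TotalAction (proj1 flag_act_is_total) (proj2 flag_act_is_total).

End Actions.

Arguments subspace_action {F n}.
Arguments flag_action {F n r}.

(* Main.v *)
(** Over the whole union, the maps f |-> f_a and f |-> f_b are injective:
    different orbits stay different after projection, and each single orbit is
    a disjoint code.  This gives the cardinality.  A sum of distances is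
    maximal iff every term is, so an optimum distance code has projected codes
    of maximum distance.  Conversely, distinct flags f, g satisfy
    f_a :&: g_a = 0, hence f_i :&: g_i = 0 for all i <= a, and
    f_b + g_b is the whole space, hence so is f_i + g_i for all i >= b. *)
Require Import Defs.
From mathcomp Require Import all_boot all_order all_algebra all_fingroup.
From mathcomp Require Import zify.

Set Implicit Arguments.
Unset Strict Implicit.
Unset Printing Implicit Defensive.

(** * Minimum distances that attain an upper bound *)

(** A minimum equal to an upper bound makes all distances equal. The default value [0] of
    [min_distance] differs from [D] because [0 < D], so the code must have two elements. *)
Lemma min_distance_eq_bound (T : finType) (d : T -> T -> nat) (C : {set T})
    (D : nat) :
    0 < D -> {in C &, forall x y, d x y <= D} ->
  min_distance d C = D <->
  1 < #|C| /\ {in C &, forall x y, x != y -> d x y = D}.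
Proof.
move=> D_gt0 d_le; rewrite /min_distance; case: pickP => [p0 p0C | no_pair].
  case: arg_minnP => //= p; rewrite inE => /and3P[p1C p2C p_neq] p_min.
  split=> [dpD | [_ ->] //]; split.
    by apply/card_gt1P; exists p.1, p.2.
  move=> x y xC yC neq_xy; apply/eqP; rewrite eqn_leq d_le //= -dpD.
  by apply: (p_min (x, y)); rewrite inE /= xC yC.
split=> [D0 | [/card_gt1P[x [y [xC yC neq_xy]]] _]]; first by rewrite -D0 in D_gt0.
by have := no_pair (x, y); rewrite !inE /= xC yC neq_xy.
Qed.

(** * Subspaces of equal dimension and their largest distance *)

Definition max_subspace_distance (n k : nat) : nat :=
  if 2 * k <= n then 2 * k else 2 * (n - k).

Lemma max_subspace_distance_gt0 (n k : nat) :
  0 < k < n -> 0 < max_subspace_distance n k.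
Proof. by rewrite /max_subspace_distance; case: ifP; lia. Qed.

Section SubspaceDistance.
Variables (F : finFieldType) (n k : nat) (U V : {vspace 'rV[F]_n}).
Hypotheses (dimU : \dim U = k) (dimV : \dim V = k).

Lemma subspace_distance_cap :
  subspace_distance U V = 2 * (k - \dim (U :&: V)).
Proof.
have := dimv_sum_cap U V; have := dimvS (capvSl U V).
by rewrite /subspace_distance dimU dimV; lia.
Qed.

Lemma subspace_distance_add :
  subspace_distance U V = 2 * (\dim (U + V) - k).
Proof.
have := dimv_sum_cap U V; have := dimvS (capvSl U V).
by rewrite /subspace_distance dimU dimV; lia.
Qed.

Lemma dimv_rV_le (W : {vspace 'rV[F]_n}) : \dim W <= n.
Proof. by have := dimvS (subvf W); rewrite dimvf /dim /= mul1n. Qed.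

(** The intersection form of the distance gives the bound [2 * k]; the sum form gives [2 * (n - k)],
    since [U + V] has dimension at most [n]. *)
Lemma subspace_distance_le :
  subspace_distance U V <= max_subspace_distance n k.
Proof.
rewrite /max_subspace_distance; case: ifP => _.
  by rewrite subspace_distance_cap; lia.
by rewrite subspace_distance_add; have := dimv_rV_le (U + V); lia.
Qed.

Lemma max_subspace_distance_cap0 : 2 * k <= n ->
  subspace_distance U V = max_subspace_distance n k <-> \dim (U :&: V) = 0.
Proof.
move=> k_le; rewrite /max_subspace_distance k_le subspace_distance_cap.
by have := dimvS (capvSl U V); rewrite dimU; lia.
Qed.

(** When [2 * k = n] the conditional selects [2 * k], which then equals [2 * (n - k)]. *)
Lemma max_subspace_distance_addf : n <= 2 * k ->
  subspace_distance U V = max_subspace_distance n k <-> \dim (U + V) = n.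
Proof.
move=> k_ge; rewrite subspace_distance_add /max_subspace_distance.
have := dimv_rV_le (U + V); have := dimvS (addvSl U V); rewrite dimU.
by case: ifP; lia.
Qed.

End SubspaceDistance.

Lemma max_distance_codeP (F : finFieldType) (n k : nat)
    (C : {set {vspace 'rV[F]_n}}) :
    0 < k < n -> (forall U, U \in C -> \dim U = k) ->
  max_distance_code k C <->
  1 < #|C| /\
  {in C &, forall U V,
     U != V -> subspace_distance U V = max_subspace_distance n k}.
Proof.
move=> k_bounds dimC.
have le_max : {in C &, forall U V,
    subspace_distance U V <= max_subspace_distance n k}.
  by move=> U V UC VC; apply: subspace_distance_le; apply: dimC.
have minP := min_distance_eq_bound (max_subspace_distance_gt0 k_bounds) le_max.
split=> [[_ _ /minP] // | CP]; split=> //; last exact/minP.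
by rewrite -card_gt0; case: CP => /ltnW.
Qed.

(** * Optimum distance flag codes and their projected codes *)

Section FlagCode.
Variables (F : finFieldType) (n r : nat) (t : 'I_r -> nat).
Local Notation flag := {ffun 'I_r -> {vspace 'rV[F]_n}}.
Variable C : {set flag}.
Hypotheses (t_type : is_flag_type n t) (C_flag : flag_code t C).

Lemma optimum_flag_distanceE :
  2 * (\sum_(i < r | 2 * t i <= n) t i + \sum_(i < r | n < 2 * t i) (n - t i))
  = \sum_(i < r) max_subspace_distance n (t i).
Proof.
rewrite mulnDr !big_distrr /= [RHS](bigID (fun i => 2 * t i <= n)) /=.
congr (_ + _); last under eq_bigl => i do rewrite ltnNge.
  by apply: eq_bigr => i ti; rewrite /max_subspace_distance ti.
by apply: eq_bigr => i /negbTE ti; rewrite /max_subspace_distance ti.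
Qed.

Lemma flag_code_subspace_distance_le (i : 'I_r) :
  {in C &, forall f g : flag,
     subspace_distance (f i) (g i) <= max_subspace_distance n (t i)}.
Proof.
case: C_flag => _ C_is f g /C_is[dimf _] /C_is[dimg _].
exact: subspace_distance_le.
Qed.

Lemma optimum_distance_flag_codeP :
  optimum_distance_flag_code t C <->
  1 < #|C| /\
  {in C &, forall f g : flag, f != g -> forall i,
     subspace_distance (f i) (g i) = max_subspace_distance n (t i)}.
Proof.
case: t_type => r_gt0 t_bounds _.
have sum_gt0 : 0 < \sum_(i < r) max_subspace_distance n (t i).
  by rewrite (bigD1 (Ordinal r_gt0)) //= addn_gt0 max_subspace_distance_gt0.
have le_sum : {in C &, forall f g : flag,
    flag_distance f g <= \sum_(i < r) max_subspace_distance n (t i)}.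
  move=> f g fC gC; apply: leq_sum => i _.
  exact: flag_code_subspace_distance_le.
have minP := min_distance_eq_bound sum_gt0 le_sum.
rewrite /optimum_distance_flag_code optimum_flag_distanceE; split.
  case=> _ /minP[C_gt1 dC]; split=> // f g fC gC neq_fg i.
  (* The equality case of the termwise bound: the sums agree only if all terms do. *)
  have le_fg j : true -> subspace_distance (f j) (g j)
      <= max_subspace_distance n (t j) ?= iff
      (subspace_distance (f j) (g j) == max_subspace_distance n (t j)).
    by move=> _; split=> //; apply: flag_code_subspace_distance_le.
  have [_] := leqif_sum le_fg.
  by rewrite -(dC f g fC gC neq_fg) eqxx => /esym/forallP/(_ i)/eqP.
case=> C_gt1 dC; split=> //; apply/minP; split=> // f g fC gC neq_fg.
by apply: eq_bigr => i _; apply: dC.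
Qed.

Lemma dim_projected_code (i : 'I_r) U : U \in projected_code C i -> \dim U = t i.
Proof. by case/imsetP=> f fC ->; case: C_flag => _ /(_ f fC)[]. Qed.

Lemma max_distance_projected_code (i : 'I_r) :
  optimum_distance_flag_code t C -> max_distance_code (t i) (projected_code C i).
Proof.
case: t_type => _ t_bounds _ /optimum_distance_flag_codeP[C_gt1 dC].
apply/max_distance_codeP => //; first exact: dim_projected_code.
split; last first.
  move=> U V /imsetP[f fC ->] /imsetP[g gC ->] neq_fg.
  by apply: dC => //; apply: contra_neq neq_fg => ->.
have [f [g [fC gC neq_fg]]] := card_gt1P C_gt1.
apply/card_gt1P; exists (f i), (g i); split; try exact: imset_f.
(* A shared [i]-th subspace would contribute distance [0], whereas the maximum is positive. *)
apply/eqP=> eq_fg; have := dC f g fC gC neq_fg i.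
have := max_subspace_distance_gt0 (t_bounds i).
by rewrite eq_fg /subspace_distance addvv capvv subnn => /[swap] <-.
Qed.

Lemma flag_subv (f : flag) (i j : 'I_r) :
  is_flag t f -> i <= j -> (f i <= f j)%VS.
Proof.
case=> _ f_incr; rewrite leq_eqVlt => /predU1P[/val_inj-> //|].
by case/f_incr/andP.
Qed.

Lemma index_a_exists (i : 'I_r) :
  2 * t i <= n -> exists a, is_index_a n t a.
Proof.
move=> ti; case: (@arg_maxnP _ i (fun j => 2 * t j <= n) val ti) => a ta a_max.
by exists a.
Qed.

Lemma index_b_exists (i : 'I_r) :
  n <= 2 * t i -> exists b, is_index_b n t b.
Proof.
move=> ti; case: (@arg_minnP _ i (fun j => n <= 2 * t j) val ti) => b tb b_min.
by exists b.
Qed.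

Lemma index_exists :
  (exists a, is_index_a n t a) \/ (exists b, is_index_b n t b).
Proof.
case: t_type => r_gt0 _ _; have [ti|/ltnW ti] := leqP (2 * t (Ordinal r_gt0)) n.
  by left; apply: index_a_exists ti.
by right; apply: index_b_exists ti.
Qed.

(** Injectivity at [a] and [b] carries the distances of the projected codes over to all pairs of
    distinct flags; nestedness of the flags then spreads extremality to the other indices. *)
Lemma optimum_of_max_distance :
    (forall a, is_index_a n t a -> {in C &, injective (fun f : flag => f a)}) ->
    (forall b, is_index_b n t b -> {in C &, injective (fun f : flag => f b)}) ->
    (forall a, is_index_a n t a -> max_distance_code (t a) (projected_code C a)) ->
    (forall b, is_index_b n t b -> max_distance_code (t b) (projected_code C b)) ->
  optimum_distance_flag_code t C.
Proof.
move=> inj_a inj_b max_a max_b; case: (t_type) => _ t_bounds _.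
have maxP i : max_distance_code (t i) (projected_code C i) -> _ :=
  (max_distance_codeP (t_bounds i) (@dim_projected_code i)).1.
have maxd i f g : max_distance_code (t i) (projected_code C i) ->
    {in C &, injective (fun f : flag => f i)} -> f \in C -> g \in C -> f != g ->
    subspace_distance (f i) (g i) = max_subspace_distance n (t i).
  move=> /maxP[_ di] inj_i fC gC neq_fg; apply: di; try exact: imset_f.
  by apply: contra_neq neq_fg; apply: inj_i.
apply/optimum_distance_flag_codeP; split.
  have gt1 i : max_distance_code (t i) (projected_code C i) -> 1 < #|C|.
    by case/maxP=> + _ => /leq_trans; apply; apply: leq_imset_card.
  (* At least one of the two indices exists, and its projected code already has two elements. *)
  by case: index_exists => -[i ?]; apply: (gt1 i); [apply: max_a | apply: max_b].
move=> f g fC gC neq_fg i; case: C_flag => _ C_is.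
have [f_is g_is] := (C_is f fC, C_is g gC).
case: (f_is) (g_is) => dimf _ [dimg _].
have [ti|/ltnW ti] := leqP (2 * t i) n.
  have [a a_idx] := index_a_exists ti; have [ta a_max] := a_idx.
  apply/(max_subspace_distance_cap0 (dimf i) (dimg i) ti).
  apply/eqP; rewrite -leqn0.
  have cap0 : \dim (f a :&: g a) = 0.
    by apply/(max_subspace_distance_cap0 (dimf a) (dimg a) ta);
      apply: (maxd a f g (max_a a a_idx) (inj_a a a_idx)).
  apply: leq_trans (eq_leq cap0).
  (* Maximality of [a] gives [i <= a], so [f i :&: g i] lies in [f a :&: g a]. *)
  by apply: dimvS; apply: capvS; apply: flag_subv; auto.
have [b b_idx] := index_b_exists ti; have [tb b_min] := b_idx.
apply/(max_subspace_distance_addf (dimf i) (dimg i) ti).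
apply/eqP; rewrite eqn_leq dimv_rV_le /=.
have addf : \dim (f b + g b) = n.
  by apply/(max_subspace_distance_addf (dimf b) (dimg b) tb);
    apply: (maxd b f g (max_b b b_idx) (inj_b b b_idx)).
apply: leq_trans (eq_leq (esym addf)) _.
(* Dually, [b <= i], so [f i + g i] contains [f b + g b]. *)
by apply: dimvS; apply: addvS; apply: flag_subv; auto.
Qed.

End FlagCode.

(** * Projections of a union of orbits *)

Section UnionOfOrbits.
Variables (F : finFieldType) (n r m : nat) (t : 'I_r -> nat).
Local Notation flag := {ffun 'I_r -> {vspace 'rV[F]_n.+1}}.
Variable Fl : 'I_m -> flag.
Variable H : {group {'GL_n.+1[F]}}.

Let C := \bigcup_(j < m) orbit flag_action H (Fl j).

Lemma projected_orbit (f : flag) (i : 'I_r) :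
  projected_code (orbit flag_action H f) i = orbit subspace_action H (f i).
Proof.
rewrite /projected_code /orbit -imset_comp; apply: eq_imset => A.
by rewrite /= ffunE.
Qed.

Lemma projected_bigcup_orbit (i : 'I_r) :
  projected_code C i = \bigcup_(j < m) orbit subspace_action H (Fl j i).
Proof.
apply/setP=> U; apply/imsetP/bigcupP=> [[f /bigcupP[j _ fj] ->]|[j _]].
  by exists j => //; rewrite -projected_orbit; apply: imset_f.
rewrite -projected_orbit => /imsetP[f fj ->]; exists f => //.
by apply/bigcupP; exists j.
Qed.

(** Projection commutes with the action, so the common subspace lies in the orbits of both [Fl j i]
    and [Fl k i]; these orbits therefore coincide. *)
Lemma orbit_index_uniq (i : 'I_r) (j k : 'I_m) f g :
    injective (fun j => orbit subspace_action H (Fl j i)) ->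
    f \in orbit flag_action H (Fl j) -> g \in orbit flag_action H (Fl k) ->
  f i = g i -> j = k.
Proof.
move=> inj_i fj gk eq_fg; apply: inj_i.
have [fij gik] : f i \in orbit subspace_action H (Fl j i)
    /\ g i \in orbit subspace_action H (Fl k i).
  by rewrite -!projected_orbit; split; apply: imset_f.
by rewrite -(orbit_eqP fij) eq_fg (orbit_eqP gik).
Qed.

Lemma bigcup_orbit_proj_inj (i : 'I_r) :
    (forall j, disjoint_flag_code t (orbit flag_action H (Fl j))) ->
    injective (fun j => orbit subspace_action H (Fl j i)) ->
  {in C &, injective (fun f : flag => f i)}.
Proof.
move=> disj inj_i f g /bigcupP[j _ fj] /bigcupP[k _ gk] eq_fg.
have eq_jk := orbit_index_uniq inj_i fj gk eq_fg; rewrite -eq_jk in gk.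
(* Within one orbit, the projection preserves cardinality, hence is injective. *)
by have [_ /(_ i)/eqP/imset_injP inj_j] := disj j; apply: inj_j.
Qed.

Lemma card_bigcup_orbit (i : 'I_r) :
    injective (fun j => orbit subspace_action H (Fl j i)) ->
  #|C| = \sum_(j < m) #|orbit flag_action H (Fl j)|.
Proof.
move=> inj_i; rewrite -!sum1_card partition_disjoint_bigcup /=.
  by apply: eq_bigr => j _; rewrite sum1_card.
move=> j k neq_jk; apply/pred0Pn => -[f /andP[fj fk]].
(* A flag common to two orbits shares its [i]-th subspace with itself, which identifies the
   indices. *)
by rewrite (orbit_index_uniq inj_i fj fk erefl) eqxx in neq_jk.
Qed.

End UnionOfOrbits.

Theorem theorem4p13 (F : finFieldType) (n r m : nat) (t : 'I_r -> nat)
    (Fl : 'I_m -> {ffun 'I_r -> {vspace 'rV[F]_n.+1}})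
    (H : {group {'GL_n.+1[F]}})
    (m_gt0 : 0 < m)
    (t_type : is_flag_type n.+1 t)
    (Fl_flag : forall j, is_flag t (Fl j))
    (orb_disjoint :
       forall j, disjoint_flag_code t (orbit flag_action H (Fl j)))
    (orb_a : forall a, is_index_a n.+1 t a ->
       injective (fun j => orbit subspace_action H (Fl j a)))
    (orb_b : forall b, is_index_b n.+1 t b ->
       injective (fun j => orbit subspace_action H (Fl j b))) :
  #|\bigcup_(j < m) orbit flag_action H (Fl j)|
    = \sum_(j < m) #|orbit flag_action H (Fl j)|
  /\ (optimum_distance_flag_code t (\bigcup_(j < m) orbit flag_action H (Fl j))
      <->
      (forall a, is_index_a n.+1 t a ->
         max_distance_code (t a)
           (\bigcup_(j < m) orbit subspace_action H (Fl j a))) /\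
      (forall b, is_index_b n.+1 t b ->
         max_distance_code (t b)
           (\bigcup_(j < m) orbit subspace_action H (Fl j b)))).
Proof.
have C_flag : flag_code t (\bigcup_(j < m) orbit flag_action H (Fl j)).
  split.
    apply/set0Pn; exists (Fl (Ordinal m_gt0)).
    by apply/bigcupP; exists (Ordinal m_gt0) => //; apply: orbit_refl.
  by move=> f /bigcupP[j _]; have [[_ + _]] := orb_disjoint j; apply.
split.
  (* Either index suffices for the cardinality, and at least one exists. *)
  case: (index_exists t_type) => -[i i_idx].
    exact: card_bigcup_orbit (orb_a i i_idx).
  exact: card_bigcup_orbit (orb_b i i_idx).
split=> [opt | [max_a max_b]].
  by split=> i _; rewrite -projected_bigcup_orbit;
    apply: max_distance_projected_code.
apply: optimum_of_max_distance => // i i_idx; last first.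
- by rewrite projected_bigcup_orbit; apply: max_b.
- by rewrite projected_bigcup_orbit; apply: max_a.
- by apply: bigcup_orbit_proj_inj orb_disjoint _; apply: orb_b.
by apply: bigcup_orbit_proj_inj orb_disjoint _; apply: orb_a.
Qed.
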